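(* Let $d\ge1$ and a vector of degrees $\mathbf{p}=(p_1,\dots,p_d)$ be fixed, and let $\Omega=[0,1]^d$. There exists a constant $C_F>0$ such that for every tensor product B-spline basis function $\beta$ (of degrees $\mathbf{p}$) on $\Omega$ with $\beta|_{\partial\Omega}\not\equiv0$ (so $C_F$ is independent of $\beta$), $$\|v\|_{L^2(\omega_\beta,\beta)}\le C_F\operatorname{diam}(\omega_\beta)\,\|\nabla v\|_{L^2(\omega_\beta,\beta)}$$ for all $v\in H^1(\omega_\beta,\beta)$ satisfying $v|_{\Gamma_\beta}\equiv0$, where $\Gamma_\beta:=\partial\Omega\cap\partial\omega_\beta$, which is a set with positive $(d-1)$-dimensional measure.
   Context: **B-splines.** For integers $p\ge1$, $n\ge p+1$, a $p$-open knot vector is a sequence $\Xi=\{\xi_j\}_{j=1}^{n+p+1}$ with $0=\xi_1=\dots=\xi_{p+1}<\xi_{p+2}\le\dots\le\xi_n<\xi_{n+1}=\dots=\xi_{n+p+1}=1$, each internal knot being repeated at most $p+1$ times. $\mathcal{B}(\Xi)=\{b_1,\dots,b_n\}$ is the associated (normalized, partition-of-unity) B-spline basis of degree $p$; $b_j$ has local knot vector $\{\xi_j,\dots,\xi_{j+p+1}\}$ and support $[\xi_j,\xi_{j+p+1}]$. Given degrees $\mathbf{p}=(p_1,\dots,p_d)$ and a $p_i$-open knot vector $\Xi_i$ in each coordinate direction $i=1,\dots,d$, a tensor product B-spline basis function is a function on $[0,1]^d$ of the form $\beta(x)=\beta_1(x_1)\cdots\beta_d(x_d)$ with $\beta_i\in\mathcal{B}(\Xi_i)$.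 Its support $\omega_\beta:=\operatorname{supp}\beta=\operatorname{supp}\beta_1\times\dots\times\operatorname{supp}\beta_d$ is a closed box. **Weighted spaces.** For a nonnegative locally integrable weight $\rho$ on $A$, $L^2(A,\rho)$ is the space of measurable functions $u$ with $\|u\|_{L^2(A,\rho)}:=\left(\int_A|u|^2\rho\,dx\right)^{1/2}<\infty$, and $H^1(A,\rho)$ is the space of weakly differentiable functions $u$ (on the interior of $A$) with $\|u\|_{L^2(A,\rho)}^2+\|\nabla u\|_{L^2(A,\rho)}^2<\infty$. Boundary values are understood in the sense of traces; $\operatorname{diam}$ is the Euclidean diameter. For $d=1$, the $(d-1)$-dimensional measure is the counting measure. *)

(* Defs.v *)
From HB Require Import structures.
From mathcomp Require Import all_boot all_order all_algebra.
From mathcomp Require Import all_classical all_reals all_analysis.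

Set Implicit Arguments.
Unset Strict Implicit.
Unset Printing Implicit Defensive.
Import Order.TTheory GRing.Theory Num.Theory.
Import numFieldNormedType.Exports.
Local Open Scope classical_set_scope.
Local Open Scope ring_scope.

Section measurable_rV.
Context (R : realType) (n : nat).

Let coors : 'I_n -> 'rV[R]_n -> R := fun i x => x 0 i.

Let rV_set0 : g_sigma_preimage coors set0.
Proof. exact: sigma_algebra0. Qed.

Let rV_setC A : g_sigma_preimage coors A -> g_sigma_preimage coors (~` A).
Proof. exact: sigma_algebraC. Qed.

Let rV_bigcup (F : _^nat) : (forall i, g_sigma_preimage coors (F i)) ->
  g_sigma_preimage coors (\bigcup_i (F i)).
Proof. exact: sigma_algebra_bigcup. Qed.

(** The product sigma-algebra, i.e. the one generated by the coordinates; it is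
    the Borel sigma-algebra of the (sup-norm) topology of ['rV[R]_n]. *)
HB.instance Definition _ :=
  @isMeasurable.Build (measure_tuple_display R.-ocitv.-measurable.-sigma)
    'rV[R]_n (g_sigma_preimage coors) rV_set0 rV_setC rV_bigcup.

End measurable_rV.

Section insert_coordinate.
Context (R : realType) (n : nat).

Definition rV_insert (i : 'I_n.+1) (t : R) (y : 'rV[R]_n) : 'rV[R]_n.+1 :=
  \row_k oapp (y 0) t (unlift i k).

Lemma measurable_coord (i : 'I_n) :
  measurable_fun [set: 'rV[R]_n] (fun x : 'rV[R]_n => x 0 i : measurableTypeR R).
Proof.
move=> _ Y mY; rewrite setTI; apply: sub_sigma_algebra => /=.
rewrite -bigcup_seq/=; exists i => /=; first by rewrite mem_index_enum.
by exists Y => //; rewrite setTI.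
Qed.

Lemma measurable_rVP d (T : measurableType d) (f : T -> 'rV[R]_n) :
  (forall i, measurable_fun [set: T] (fun x => f x 0 i : measurableTypeR R)) ->
  measurable_fun [set: T] f.
Proof.
move=> fS.
suff : g_sigma_preimage (fun i x => f x 0 i) `<=` @measurable _ T.
  rewrite (g_sigma_preimage_comp (fun i (x : 'rV[R]_n) => x 0 i) f) => H.
  by move=> _ A mA; apply: H; exists A.
apply: smallest_sub; first exact: sigma_algebra_measurable.
case: n => [|m] in f fS *; first by rewrite big_ord0.
rewrite -bigcup_mkord_ord; apply: bigcup_sub => i Ii.
by move=> A [B mB <-]; exact: fS.
Qed.

End insert_coordinate.

Lemma measurable_rV_insert (R : realType) (n : nat) d (T : measurableType d)
    (i : 'I_n.+1) (t : T -> measurableTypeR R) (y : T -> 'rV[R]_n) :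
  measurable_fun [set: T] t -> measurable_fun [set: T] y ->
  measurable_fun [set: T] (fun x => rV_insert i (t x) (y x)).
Proof.
move=> mt my; apply: measurable_rVP => k.
rewrite (_ : (fun x => _) = fun x => oapp (y x 0) (t x) (unlift i k)); last first.
  by apply/funext => x; rewrite mxE.
case: unlift => [l|] //=.
exact: (measurableT_comp (measurable_coord l)).
Qed.

Section lebesgue_cons.
Context (R : realType) (n : nat).
Variable mu : {sigma_finite_measure set 'rV[R]_n -> \bar R}.

Let cons (ty : measurableTypeR R * 'rV[R]_n) : 'rV[R]_n.+1 :=
  rV_insert ord0 ty.1 ty.2.

Let mcons : measurable_fun setT cons.
Proof. exact: measurable_rV_insert. Qed.

Definition lebesgue_cons : set 'rV[R]_n.+1 -> \bar R :=
  pushforward (@lebesgue_measure R \x mu)%E cons.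

Let lebesgue_cons0 : lebesgue_cons set0 = 0%E.
Proof. by rewrite /lebesgue_cons /pushforward preimage_set0 measure0. Qed.

Let lebesgue_cons_ge0 A : (0 <= lebesgue_cons A)%E.
Proof. exact: measure_ge0. Qed.

Let lebesgue_cons_sigma_additive : semi_sigma_additive lebesgue_cons.
Proof.
exact: (@measure_semi_sigma_additive _ _ _
  (pushforward (@lebesgue_measure R \x mu)%E cons)).
Qed.

HB.instance Definition _ := isMeasure.Build _ _ _ lebesgue_cons
  lebesgue_cons0 lebesgue_cons_ge0 lebesgue_cons_sigma_additive.

Let lebesgue_cons_sigma_finite : sigma_finite setT lebesgue_cons.
Proof.
have [F [TF Foo]] : exists F : (set (measurableTypeR R * 'rV[R]_n))^nat,
    setT = \bigcup_k F k /\ forall k, measurable (F k) /\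
    ((@lebesgue_measure R \x mu) (F k) < +oo)%E.
  have /sigma_finiteP[F [TF ndF Foo]] := sigma_finiteT (@lebesgue_measure R).
  have /sigma_finiteP[G [TG ndG Goo]] := sigma_finiteT mu.
  exists (fun k => F k `*` G k); split.
    rewrite -setXTT TF TG predeqE => -[x y]; split.
      move=> [/= [k _ Fkx] [l _ Gly]]; exists (maxn k l) => //; split.
      - by move: x Fkx; exact/subsetPset/ndF/leq_maxl.
      - by move: y Gly; exact/subsetPset/ndG/leq_maxr.
    by move=> [k _ []/= ? ?]; split; exists k.
  move=> k; have [? ?] := Foo k; have [? ?] := Goo k.
  split; first exact: measurableX.
  by rewrite product_measure1E// lte_mul_pinfty// ge0_fin_numE.
pose uncons (x : 'rV[R]_n.+1) : measurableTypeR R * 'rV[R]_n :=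
  (x 0 ord0, \row_k x 0 (lift ord0 k)).
have consK : cancel cons uncons.
  move=> [t y]; rewrite /uncons /cons /rV_insert /=; congr pair.
    by rewrite mxE unlift_none.
  by apply/rowP => k; rewrite !mxE liftK.
have muncons : measurable_fun setT uncons.
  apply/measurable_fun_pairP; split => /=; first exact: measurable_coord.
  apply: measurable_rVP => k.
  rewrite (_ : (fun x => _) = fun x : 'rV[R]_n.+1 => x 0 (lift ord0 k)).
    exact: measurable_coord.
  by apply/funext => x /=; rewrite mxE.
exists (fun k => uncons @^-1` F k).
  by rewrite -preimage_bigcup -TF preimage_setT.
move=> k; have [mF Fk] := Foo k; split.
  by rewrite -[X in measurable X]setTI; exact: muncons.
rewrite /lebesgue_cons /pushforward -comp_preimage.
by rewrite (_ : uncons \o cons = id) //; apply/funext => x; exact: consK.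
Qed.

HB.instance Definition _ := @Measure_isSigmaFinite.Build _ _ _ lebesgue_cons
  lebesgue_cons_sigma_finite.

End lebesgue_cons.

Fixpoint lebesgue_rV (R : realType) (n : nat) :
    {sigma_finite_measure set 'rV[R]_n -> \bar R} :=
  match n with
  | 0 => @dirac _ 'rV[R]_0 0 R
  | m.+1 => lebesgue_cons (lebesgue_rV R m)
  end.

Section unit_cube_surface.
Context (R : realType) (n : nat).

Definition hyperplane_measure (i : 'I_n.+1) (a : R) :
    set 'rV[R]_n.+1 -> \bar R :=
  pushforward (lebesgue_rV R n) (rV_insert i a).

Let mrV_insert i a : measurable_fun setT (@rV_insert R n i a).
Proof. exact: measurable_rV_insert. Qed.

Let hyperplane_measure0 i a : hyperplane_measure i a set0 = 0%E.
Proof. exact: measure0. Qed.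

Let hyperplane_measure_ge0 i a A : (0 <= hyperplane_measure i a A)%E.
Proof. exact: measure_ge0. Qed.

Let hyperplane_measure_sigma_additive i a :
  semi_sigma_additive (hyperplane_measure i a).
Proof.
have mf := mrV_insert i a.
exact: (@measure_semi_sigma_additive _ _ _
  (pushforward (lebesgue_rV R n) (rV_insert i a))).
Qed.

HB.instance Definition _ i a := isMeasure.Build _ _ _ (hyperplane_measure i a)
  (hyperplane_measure0 i a) (@hyperplane_measure_ge0 i a)
  (@hyperplane_measure_sigma_additive i a).

(** The [n]-dimensional surface measure carried by the hyperplanes [x_i = 0] and
    [x_i = 1].  On subsets of the boundary of [[0, 1]^(n+1)] it is the surface
    measure of that boundary (two faces meet in a null set); for [n = 0] it is the
    counting measure of [{0, 1}]. *)
Definition unit_cube_surface : set 'rV[R]_n.+1 -> \bar R := fun A =>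
  (\sum_(i < n.+1) (hyperplane_measure i 0 A + hyperplane_measure i 1 A))%E.

Let unit_cube_surfaceE : unit_cube_surface =
  msum (fun k => measure_add (hyperplane_measure (inord k) 0)
                             (hyperplane_measure (inord k) 1)) n.+1.
Proof.
apply/funext => A; apply: eq_bigr => i _.
have := measure_addE (hyperplane_measure (inord i) 0)
  (hyperplane_measure (inord i) 1) A.
by rewrite inord_val => <-.
Qed.

Let unit_cube_surface0 : unit_cube_surface set0 = 0%E.
Proof. by rewrite unit_cube_surfaceE measure0. Qed.

Let unit_cube_surface_ge0 A : (0 <= unit_cube_surface A)%E.
Proof. by rewrite unit_cube_surfaceE measure_ge0. Qed.

Let unit_cube_surface_sigma_additive : semi_sigma_additive unit_cube_surface.
Proof. rewrite unit_cube_surfaceE; exact: measure_semi_sigma_additive. Qed.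

HB.instance Definition _ := isMeasure.Build _ _ _ unit_cube_surface
  unit_cube_surface0 unit_cube_surface_ge0 unit_cube_surface_sigma_additive.

End unit_cube_surface.

Section euclidean.
Context (R : realType) (d : nat).
Implicit Types (A : set 'rV[R]_d) (x y : 'rV[R]_d).

Definition unit_cube : set 'rV[R]_d := [set x | forall i, 0 <= x 0 i <= 1].

Definition boundary A : set 'rV[R]_d := closure A `\` A°.

(** The library's norm on ['rV[R]_d] is the sup norm. *)
Definition enorm x : R := Num.sqrt (\sum_i x 0 i ^+ 2).

Definition ediam A : R :=
  sup [set r | exists x y, [/\ A x, A y & r = enorm (x - y)]].

End euclidean.

Section bspline.
Context (R : realType).
Implicit Types (Xi : seq R) (p n j : nat) (x : R).

(** Knots and B-splines are numbered from [0]: the knots are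
    [Xi`_0, ..., Xi`_(n + p)] and the B-splines those of index [j < n]. *)
Definition open_knot_vector p n Xi : Prop :=
  [/\ (p.+1 <= n)%N, size Xi = (n + p).+1 &
   [/\ forall k, (k <= p)%N -> Xi`_k = 0,
       forall k, (n <= k <= n + p)%N -> Xi`_k = 1,
       Xi`_p < Xi`_p.+1 /\ Xi`_n.-1 < Xi`_n,
       forall k, (p.+1 <= k)%N -> (k.+1 < n)%N -> Xi`_k <= Xi`_k.+1 &
       forall z, 0 < z < 1 -> (count_mem z Xi <= p.+1)%N]].

(** Cox-de Boor recursion; [0 / 0] is [0] since [0^-1 = 0] in the library.  The
    degree-zero functions are right-continuous, except at the last knot, which
    belongs to the last nonempty knot span. *)
Fixpoint bspline Xi p j x : R :=
  match p with
  | 0 => ((Xi`_j <= x < Xi`_j.+1) ||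
          [&& Xi`_j < x, x == Xi`_j.+1 & x == last 0 Xi])%:R
  | q.+1 =>
      (x - Xi`_j) / (Xi`_(j + q.+1) - Xi`_j) * bspline Xi q j x +
      (Xi`_(j + q.+2) - x) / (Xi`_(j + q.+2) - Xi`_j.+1) * bspline Xi q j.+1 x
  end.

Definition tensor_bspline d (p : 'I_d -> nat) (Xi : 'I_d -> seq R)
    (j : 'I_d -> nat) (x : 'rV[R]_d) : R :=
  \prod_(i < d) bspline (Xi i) (p i) (j i) (x 0 i).

End bspline.

Definition supp (R : realType) d (f : 'rV[R]_d -> R) : set 'rV[R]_d :=
  closure [set x | f x != 0].

Section sobolev.
Context (R : realType) (d : nat).
Implicit Types (A U G : set 'rV[R]_d) (u v w rho phi : 'rV[R]_d -> R).
Implicit Types (g : 'rV[R]_d -> 'rV[R]_d).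

Definition partial (i : 'I_d) u (x : 'rV[R]_d) : R := 'D_(delta_mx 0 i) u x.

Definition grad u (x : 'rV[R]_d) : 'rV[R]_d := \row_i partial i u x.

(** C-infinity: all iterated partial derivatives are (Frechet) differentiable. *)
Definition smooth u : Prop :=
  forall (s : seq 'I_d) (x : 'rV[R]_d), differentiable (foldr partial u s) x.

Definition test_function U phi : Prop :=
  [/\ smooth phi, compact (supp phi) & supp phi `<=` U].

Local Notation mu := (lebesgue_rV R d).

Definition locally_integrable_on U u : Prop :=
  forall K, compact K -> K `<=` U -> mu.-integrable K (EFin \o u).

Definition weak_gradient U v g : Prop :=
  [/\ locally_integrable_on U v,
      forall i, locally_integrable_on U (fun x => g x 0 i) &
      forall i phi, test_function U phi ->
        \int[mu]_(x in U) (v x * partial i phi x) =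
        - \int[mu]_(x in U) (g x 0 i * phi x)].

Definition L2norm (m : set 'rV[R]_d -> \bar R) A rho u : \bar R :=
  ((\int[m]_(x in A) (`|u x| ^+ 2 * rho x)%:E) `^ 2^-1)%E.

(** [v] belongs to [H^1(A, rho)] and [g] represents its weak gradient. *)
Definition in_H1 A rho v g : Prop :=
  [/\ measurable_fun A v, forall i, measurable_fun A (fun x => g x 0 i),
      weak_gradient A° v g,
      (L2norm mu A rho v < +oo)%E &
      (L2norm mu A rho (fun x => enorm (g x)) < +oo)%E].

(** [w] is the trace on [G] of the function [v] of [H^1(A, rho)] with weak
    gradient [g]: the trace operator is the extension by continuity, from
    [H^1(A, rho)] to [L^2(G, rho dm)] ([m] the surface measure), of the restriction
    to [G] of functions that are smooth up to the boundary. *)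
Definition is_trace (m : set 'rV[R]_d -> \bar R) A rho G v g w : Prop :=
  exists phi : nat -> 'rV[R]_d -> R,
  [/\ forall k, smooth (phi k),
      L2norm mu A rho (fun x => phi k x - v x) @[k --> \oo] --> 0%E,
      L2norm mu A rho (fun x => enorm (grad (phi k) x - g x)) @[k --> \oo]
        --> 0%E &
      L2norm m G rho (fun x => phi k x - w x) @[k --> \oo] --> 0%E].

End sobolev.

(* Main.v *)
Require Import Defs.
From mathcomp Require Import all_boot all_order all_algebra.
From mathcomp Require Import all_classical all_reals all_analysis.
From mathcomp Require Import measurable_realfun ring lra.
Set Implicit Arguments.
Unset Strict Implicit.
Unset Printing Implicit Defensive.
Import Order.TTheory GRing.Theory Num.Theory.
Import numFieldNormedType.Exports.
Local Open Scope classical_set_scope.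
Local Open Scope ring_scope.

(** Let [i] be a direction in which [beta] does not vanish at an end [e] of
    [[0, 1]].  The [i]-th factor is then the first or the last B-spline, i.e.
    [((L - t) / L) ^+ p] on [[0, L]] or its mirror image, which decreases away
    from [e].  For [f] smooth and [t] at distance at most [L] from [e],
    Cauchy-Schwarz gives
    [f t ^+ 2 <= 2 * f e ^+ 2 + 2 * L * \int f' ^+ 2], the integral running from
    [e] to [t]; since the weight at [t] is at most the weight anywhere between
    [e] and [t], it can be moved into that integral.  Integrating in [t], then in
    the other coordinates, bounds the weighted norm of a smooth function by
    [L * \sqrt 2] times that of its partial derivative plus a multiple of its
    weighted norm on the face [x_i = e].  The face lies in [Gamma] up to points
    where [beta] vanishes, so the last term disappears in the limit defining the
    trace, and [L <= ediam omega]. *)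

Lemma open_measurable_rV (R : realType) (n : nat) (U : set 'rV[R]_n) :
  open U -> measurable U.
Proof.
move=> oU.
pose B (qk : 'rV[rat]_n * nat) := [set x : 'rV[R]_n |
  forall i, x 0 i \in `](ratr (qk.1 0 i) - qk.2.+1%:R^-1), (ratr (qk.1 0 i) + qk.2.+1%:R^-1)[].
have mB qk : measurable (B qk).
  rewrite (_ : B qk = \bigcap_(i in [set: 'I_n]) ((fun x : 'rV[R]_n => x 0 i) @^-1`
      `](ratr (qk.1 0 i) - qk.2.+1%:R^-1), (ratr (qk.1 0 i) + qk.2.+1%:R^-1)[)).
    apply: fin_bigcap_measurable => // i _.
    have := @measurable_coord R n i measurableT _ (measurable_itv
      `](ratr (qk.1 0 i) - qk.2.+1%:R^-1), (ratr (qk.1 0 i) + qk.2.+1%:R^-1)[).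
    by rewrite setTI.
  by apply/seteqP; split => [x + i _|x + i]; apply.
rewrite (_ : U = \bigcup_qk (if `[< B qk `<=` U >] then B qk else set0)).
  apply: countable_bigcupT_measurable => [|qk]; first exact: countableP.
  by case: asboolP.
apply/seteqP; split => [x Ux|x [qk _]]; last by case: asboolP => // + Bx; exact.
have /nbhs_ballP[e /= e0 eU] := open_nbhs_nbhs (conj oU Ux).
have [k ke] : exists k : nat, k.+1%:R^-1 < e / 2.
  have e20 : 0 < e / 2 by rewrite divr_gt0.
  exists (Num.truncn (e / 2)^-1); rewrite invf_plt ?posrE//.
  exact: truncnS_gt.
have k0 : 0 < k.+1%:R^-1 :> R by rewrite invr_gt0.
have /choice[q qP] (i : 'I_n) : exists q : rat,
    ratr q \in `](x 0 i - k.+1%:R^-1), (x 0 i + k.+1%:R^-1)[.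
  by apply: rat_in_itvoo; rewrite ltrBlDr -addrA ltrDl addr_gt0.
exists (\row_i q i, k) => //.
rewrite asboolT.
  move=> i /=; rewrite mxE; have := qP i; rewrite !in_itv/= => /andP[h1 h2].
  by rewrite ltrBlDr h2/= -ltrBlDr h1.
move=> y By; apply: eU; split => // i0 i; rewrite ord1 /ball/=.
have := By i; have := qP i; rewrite /= mxE !in_itv/= => /andP[h1 h2] /andP[h3 h4].
have h5 : k.+1%:R^-1 + k.+1%:R^-1 < e by rewrite [ltRHS]splitr ltrD.
rewrite ltr_distl; move: h1 h2 h3 h4 h5.
move: (x 0 i) (y 0 i) (ratr _) (_^-1) => a b c f *; apply/andP; split; lra.
Qed.

Lemma closed_measurable_rV (R : realType) (n : nat) (A : set 'rV[R]_n) :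
  closed A -> measurable A.
Proof.
by move=> /closed_openC/open_measurable_rV/measurableC; rewrite setCK.
Qed.

Lemma continuous_measurable_rV (R : realType) (n : nat) (f : 'rV[R]_n -> R) :
  continuous f -> measurable_fun setT f.
Proof.
move=> /continuousP cf.
apply: (measurability _ (@measurable_realfun.RGenOpens.measurableE R)).
move=> _ [_ [a [b ->]] <-]; rewrite setTI; apply: open_measurable_rV.
by apply: cf; exact: interval_open.
Qed.

Lemma rV_insert_lift (R : realType) (n : nat) (k : 'I_n.+1) (s t : R) (z : 'rV[R]_n) :
  rV_insert ord0 s (rV_insert k t z) = rV_insert (lift ord0 k) t (rV_insert ord0 s z).
Proof.
apply/rowP => l; rewrite !mxE; have [->|l0] := eqVneq l ord0.
  rewrite unlift_none /=.
  have h0 : lift (lift ord0 k) ord0 = ord0 :> 'I_n.+2 by apply/val_inj.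
  by rewrite -[in RHS]h0 liftK /= mxE unlift_none.
have [m ->] : exists m, l = lift ord0 m.
  by case: (unliftP ord0 l) l0 => [m -> _|-> /eqP//]; exists m.
rewrite liftK/= mxE; case: (unliftP k m) => [q ->|->]/=.
  have h0 : lift ord0 (lift k q) = lift (lift ord0 k) (lift ord0 q).
    by apply/val_inj; rewrite /= /bump /= ltnS !add1n addnS.
  by rewrite h0 liftK /= mxE liftK.
by rewrite unlift_none.
Qed.

Lemma integral_rV_insert (R : realType) (n : nat) (i : 'I_n.+1)
    (f : 'rV[R]_n.+1 -> \bar R) :
  measurable_fun setT f -> (forall x, 0 <= f x)%E ->
  (\int[lebesgue_rV R n.+1]_x f x =
   \int[lebesgue_rV R n]_y \int[@lebesgue_measure R]_t f (rV_insert i t y))%E.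
Proof.
have base m (g : 'rV[R]_m.+1 -> \bar R) :
    measurable_fun setT g -> (forall x, 0 <= g x)%E ->
    (\int[lebesgue_rV R m.+1]_x g x =
     \int[@lebesgue_measure R \x lebesgue_rV R m]_ty g (rV_insert ord0 ty.1 ty.2))%E.
  move=> mg g0.
  rewrite [LHS](@ge0_integral_pushforward _ _ _ _ R
    (fun ty : measurableTypeR R * 'rV[R]_m => rV_insert ord0 ty.1 ty.2)
    _ (@lebesgue_measure R \x lebesgue_rV R m)%E setT)//.
  exact: measurable_rV_insert.
have base2 m (g : 'rV[R]_m.+1 -> \bar R) :
    measurable_fun setT g -> (forall x, 0 <= g x)%E ->
    (\int[lebesgue_rV R m.+1]_x g x =
     \int[lebesgue_rV R m]_y \int[@lebesgue_measure R]_t g (rV_insert ord0 t y))%E.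
  move=> mg g0; rewrite base// fubini_tonelli2//.
  by apply: measurableT_comp => //; exact: measurable_rV_insert.
elim: n i f => [|n IH] i f mf f0; first by rewrite ord1; exact: base2.
case: (unliftP ord0 i) => [k ->|->]; last exact: base2.
rewrite base// fubini_tonelli1//; last first.
  by apply: measurableT_comp => //; exact: measurable_rV_insert.
rewrite /fubini_F/=.
under eq_integral => s _.
  rewrite (IH k (fun y => f (rV_insert ord0 s y))) //; last first.
    by apply: measurableT_comp => //; exact: measurable_rV_insert.
  under eq_integral do under eq_integral do rewrite rV_insert_lift.
  over.
pose h (sz : measurableTypeR R * 'rV[R]_n) :=
  (\int[@lebesgue_measure R]_t f (rV_insert (lift ord0 k) t (rV_insert ord0 sz.1 sz.2)))%E.
have mG : measurable_fun setT (fun y : 'rV[R]_n.+1 =>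
    \int[@lebesgue_measure R]_t f (rV_insert (lift ord0 k) t y))%E.
  apply: (@measurable_fun_fubini_tonelli_G _ _ _ _ _ (@lebesgue_measure R)
    (fun ty : measurableTypeR R * 'rV[R]_n.+1 => f (rV_insert (lift ord0 k) ty.1 ty.2))) => //.
  by apply: measurableT_comp => //; exact: measurable_rV_insert.
rewrite base//; last by move=> y; exact: integral_ge0.
rewrite fubini_tonelli1//.
  apply: (measurableT_comp mG); exact: measurable_rV_insert.
by move=> x; exact: integral_ge0.
Qed.

Definition nondecreasing_knots (R : realType) (Xi : seq R) :=
  forall a b, (a <= b < size Xi)%N -> Xi`_a <= Xi`_b.

Section open_knots.
Context (R : realType) (p n : nat) (Xi : seq R).
Hypothesis hXi : open_knot_vector p n Xi.

Lemma open_knots_nondecreasing : nondecreasing_knots Xi.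
Proof.
have [pn szXi [Xi0 Xi1 [Xip Xin] Ximid _]] := hXi.
have step k : (k < n + p)%N -> Xi`_k <= Xi`_k.+1.
  move=> knp; have [kp|pk] := ltnP k p; first by rewrite !Xi0// ltnW.
  have [->|kp] := eqVneq k p; first exact: ltW.
  have {pk kp}pk : (p < k)%N by rewrite ltn_neqAle eq_sym kp.
  have [nk|kn] := leqP n k.
    by rewrite Xi1 ?nk ?(ltnW knp)// Xi1 ?knp ?(leqW nk).
  have [kn1|kn1] := ltnP k.+1 n; first exact: Ximid.
  have -> : k = n.-1 by apply/eqP; rewrite -eqSS prednK ?eqn_leq ?kn// (leq_trans _ kn).
  by rewrite prednK ?(leq_trans _ kn)// ltW.
move=> a b /andP[ab]; rewrite szXi ltnS.
elim: b ab => [|b IH]; first by rewrite leqn0 => /eqP ->.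
rewrite leq_eqVlt => /predU1P[->//|]; rewrite ltnS => ab bnp.
exact: (le_trans (IH ab (ltnW bnp)) (step _ bnp)).
Qed.

Lemma open_knots_last : last 0 Xi = 1.
Proof.
have [pn szXi [_ Xi1 _ _ _]] := hXi.
by rewrite -nth_last szXi /= Xi1// leqnn leq_addr.
Qed.

Lemma open_knots_ge0 k : (k <= n + p)%N -> 0 <= Xi`_k.
Proof.
have [pn szXi [Xi0 _ _ _ _]] := hXi.
by move=> knp; rewrite -[leLHS](Xi0 0%N)// open_knots_nondecreasing// szXi.
Qed.

Lemma open_knots_le1 k : (k <= n + p)%N -> Xi`_k <= 1.
Proof.
have [pn szXi [_ Xi1 _ _ _]] := hXi.
move=> knp; rewrite -[leRHS](Xi1 (n + p)%N) ?leqnn ?leq_addr//.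
by rewrite open_knots_nondecreasing// szXi knp/=.
Qed.

Lemma bspline_eq0_at0 q k : (q <= p)%N -> (k + q <= n + p)%N ->
  bspline Xi q k 0 != 0 -> (k + q = p)%N.
Proof.
have [pn szXi [Xi0 _ [Xip _] _ _]] := hXi.
elim: q k => [|q IH] k qp kq /=.
  rewrite addn0 in kq *; rewrite pnatr_eq0 eqb0 negbK => /orP[|/and3P[]].
    move=> /andP[k0 k10]; apply/eqP; rewrite eqn_leq; apply/andP; split.
      rewrite leqNgt; apply/negP => pk; move: k0; rewrite leNgt => /negP; apply.
      rewrite -[ltLHS](Xi0 p)//; apply: (lt_le_trans Xip).
      by rewrite open_knots_nondecreasing// szXi ltnS pk.
    rewrite leqNgt; apply/negP => kp; move: k10.
    by rewrite Xi0// ltxx.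
  by rewrite open_knots_last => _ _ /eqP h; move: (oner_neq0 R); rewrite -h eqxx.
rewrite addnS in kq *.
apply: contraNeq => kqp.
have [->|/(IH k.+1 (ltnW qp)) kqE] := eqVneq (bspline Xi q k.+1 0) 0; last first.
  by rewrite -kqE ?addSn ?eqxx in kqp.
rewrite mulr0 addr0.
have [->|/(IH k (ltnW qp) (ltnW kq)) kqE] := eqVneq (bspline Xi q k 0) 0.
  by rewrite mulr0.
by rewrite Xi0 ?subr0 ?mul0r// -kqE leq_addr.
Qed.

Lemma bspline_eq0_at1 q k : (q <= p)%N -> (k + q < n + p)%N ->
  bspline Xi q k 1 != 0 -> k = n.-1.
Proof.
have [pn szXi [_ Xi1 [_ Xin] _ _]] := hXi.
have n0 : (0 < n)%N by exact: leq_trans pn.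
elim: q k => [|q IH] k qp kq /=.
  rewrite addn0 in kq; rewrite pnatr_eq0 eqb0 negbK => /orP[|/and3P[k1 k11 _]].
    by rewrite (ltNge 1) (open_knots_le1 kq) andbF.
  have kn : (k < n)%N.
    by rewrite ltnNge; apply: contraTN k1 => nk; rewrite Xi1 ?ltxx// nk ltnW.
  apply/eqP; rewrite -eqSS prednK// eqn_leq kn/= leqNgt.
  apply: contraTN k11 => k1n; rewrite gt_eqF//.
  apply: (@le_lt_trans _ _ Xi`_n.-1); last by rewrite [ltRHS]Xi1 ?leqnn ?leq_addr in Xin.
  apply: open_knots_nondecreasing; rewrite szXi; apply/andP; split.
    by rewrite -ltnS prednK.
  by rewrite ltnS (leq_trans (leq_pred _))// leq_addr.
rewrite addnS in kq.
have [->|/(IH k (ltnW qp) (ltnW kq)) -> //] := eqVneq (bspline Xi q k 1) 0.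
rewrite mulr0 add0r.
have [->|/(IH k.+1 (ltnW qp))] := eqVneq (bspline Xi q k.+1 1) 0.
  by rewrite mulr0 eqxx.
rewrite addSn => /(_ kq) kE; rewrite Xi1 ?subrr ?mul0r ?eqxx// !addnS.
have {}kE : n = k.+2 by rewrite kE prednK.
by rewrite kE !addSn !ltnS leq_addr/= leq_add2l ltnW.
Qed.

(* At [x = L := Xi`_p.+1] the degree-zero factor is [1] when [L] is the last knot
   and [0] otherwise; the power vanishes there for [q > 0]. *)
Lemma bspline_first q k x : (k + q = p)%N ->
  bspline Xi q k x = ((Xi`_p.+1 - x) / Xi`_p.+1) ^+ q * bspline Xi 0 p x.
Proof.
have [_ _ [Xi0 _ _ _ _]] := hXi.
elim: q k => [|q IH] k; first by rewrite addn0 expr0 mul1r => ->.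
rewrite addnS => kq; have kp : (k <= p)%N by rewrite -kq -addnS leq_addr.
have kp1 : (k.+1 <= p)%N by rewrite -kq ltnS leq_addr.
rewrite [LHS]/= (IH k.+1) ?addSn// !addnS kq (Xi0 k)// (Xi0 k.+1)// (Xi0 p)//.
rewrite !subr0 invr0 mulr0 mul0r add0r.
by rewrite exprS mulrA.
Qed.

Lemma bspline_last q x : (q <= p)%N ->
  bspline Xi q n.-1 x =
  ((x - Xi`_n.-1) / (1 - Xi`_n.-1)) ^+ q * bspline Xi 0 n.-1 x.
Proof.
have [pn _ [_ Xi1 _ _ _]] := hXi.
have n0 : (0 < n)%N by exact: leq_trans pn.
elim: q => [|q IH] qp; first by rewrite expr0 mul1r.
rewrite [LHS]/= IH ?(ltnW qp)// !addnS -!addSn prednK//.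
rewrite [Xi`_(n + q)]Xi1 ?leq_addr ?leq_add2l ?(ltnW qp)//.
rewrite [Xi`_(n.+1 + q)]Xi1 ?addSn -?addnS ?leq_addr ?leq_add2l//.
rewrite [Xi`_n]Xi1 ?leqnn ?leq_addr// subrr invr0 mulr0 mul0r addr0.
by rewrite exprS mulrA.
Qed.

End open_knots.

Section bspline_sign.
Context (R : realType) (Xi : seq R).
Hypothesis ndXi : nondecreasing_knots Xi.

Lemma bspline_itv q k x : (k + q.+1 < size Xi)%N -> bspline Xi q k x != 0 ->
  Xi`_k <= x <= Xi`_(k + q.+1).
Proof.
elim: q k => [|q IH] k kq /=.
  rewrite addn1 pnatr_eq0 eqb0 negbK => /orP[/andP[-> /ltW ->//]|].
  by move=> /and3P[/ltW -> /eqP -> _]; rewrite lexx.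
have [b0|/IH b0] := eqVneq (bspline Xi q k x) 0.
  rewrite b0 mulr0 add0r.
  have [->|/IH b1 _] := eqVneq (bspline Xi q k.+1 x) 0; first by rewrite mulr0 eqxx.
  rewrite addSnnS in b1; have /andP[kx xk] := b1 kq.
  by rewrite xk andbT (le_trans _ kx)// ndXi// leqnSn/= (leq_ltn_trans _ kq)// addnS ltnS leq_addr.
have kq' : (k + q.+1 < size Xi)%N by rewrite (ltn_trans _ kq)// ltn_add2l.
move=> _; have /andP[->/= xk] := b0 kq'.
by rewrite (le_trans xk)// ndXi// kq leq_add2l leqnSn.
Qed.

Lemma bspline_ge0 q k x : (k + q.+1 < size Xi)%N -> 0 <= bspline Xi q k x.
Proof.
elim: q k => [|q IH] k kq /=; first by rewrite ler0n.
have kq' : (k + q.+1 < size Xi)%N by rewrite (ltn_trans _ kq)// ltn_add2l.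
have kq'' : (k.+1 + q.+1 < size Xi)%N by rewrite addSnnS.
have ndk a b : (a <= b < size Xi)%N -> 0 <= (Xi`_b - Xi`_a)^-1.
  by move=> ab; rewrite invr_ge0 subr_ge0 ndXi.
apply: addr_ge0.
  have [->|/(bspline_itv kq')/andP[h _]] := eqVneq (bspline Xi q k x) 0.
    by rewrite mulr0.
  by rewrite mulr_ge0 ?IH// mulr_ge0 ?subr_ge0// ndk// kq' leq_addr.
have [->|/(bspline_itv kq'')/andP[_ h]] := eqVneq (bspline Xi q k.+1 x) 0.
  by rewrite mulr0.
rewrite addSnnS in h.
by rewrite mulr_ge0 ?IH// mulr_ge0 ?subr_ge0// ndk// kq addnS ltnS leq_addr.
Qed.

End bspline_sign.

Lemma measurable_bspline (R : realType) (Xi : seq R) q k :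
  measurable_fun setT (bspline Xi q k : measurableTypeR R -> R).
Proof.
elim: q k => [|q IH] k.
  pose D := [set` `[Xi`_k, Xi`_k.+1[ ] `|`
    (if (Xi`_k < Xi`_k.+1) && (Xi`_k.+1 == last 0 Xi) then [set Xi`_k.+1] else set0).
  rewrite (_ : bspline Xi 0 k = \1_D).
    apply: measurable_indic; apply: measurableU; first exact: measurable_itv.
    by case: ifP.
  apply/funext => x; rewrite indicE /=; congr (_%:R); rewrite in_setU; congr (_ || _).
    by rewrite mem_setE in_itv.
  have [->|xk] := eqVneq x Xi`_k.+1.
    rewrite /=; case: ifP => _; apply/esym; first exact/mem_set.
    exact/memNset.
  rewrite /= andbF; case: ifP => _; apply/esym; apply/memNset => //.
  by move=> xE; rewrite xE eqxx in xk.
rewrite /=; apply: measurable_funD; apply: measurable_funM => //.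
- by apply: measurable_funM => //; apply: measurable_funB.
- by apply: measurable_funM => //; apply: measurable_funB.
Qed.

Lemma bspline_cvg_right (R : realType) (Xi : seq R) q k x : x != last 0 Xi ->
  bspline Xi q k y @[y --> x^'+] --> bspline Xi q k x.
Proof.
move=> xl; elim: q k => [|q IH] k.
  apply: cvg_near_cst => /=.
  have e1 : \forall y \near x^'+, (Xi`_k <= y) = (Xi`_k <= x).
    have [kx|xk] := leP Xi`_k x.
      by near=> y; apply/idP; apply: (le_trans kx); apply/ltW; near: y; exact: nbhs_right_gt.
    by near=> y; apply/negbTE; rewrite -ltNge; near: y; exact: nbhs_right_lt.
  have e2 : \forall y \near x^'+, (y < Xi`_k.+1) = (x < Xi`_k.+1).
    have [kx|xk] := ltP x Xi`_k.+1.
      by near=> y; apply/idP; near: y; exact: nbhs_right_lt.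
    near=> y; apply/negbTE; rewrite -leNgt; apply: (le_trans xk); apply/ltW.
    by near: y; exact: nbhs_right_gt.
  have e3 : \forall y \near x^'+, (y == last 0 Xi) = (x == last 0 Xi).
    have [lx|xl'] := ltP (last 0 Xi) x.
      near=> y; rewrite (negbTE xl) gt_eqF//; apply: (lt_trans lx).
      by near: y; exact: nbhs_right_gt.
    near=> y; rewrite (negbTE xl) lt_eqF//; near: y; apply: nbhs_right_lt.
    by rewrite lt_neqAle xl.
  near=> y; congr (_%:R).
  have -> : (Xi`_k <= y) = (Xi`_k <= x) by near: y.
  have -> : (y < Xi`_k.+1) = (x < Xi`_k.+1) by near: y.
  have -> : (y == last 0 Xi) = (x == last 0 Xi) by near: y.
  by rewrite (negbTE xl) !andbF.
rewrite /=; have cx : y @[y --> x^'+] --> x by exact: cvg_at_right_filter.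
apply: cvgD; apply: cvgM => //.
- by apply: cvgMr_tmp; apply: cvgB => //; exact: cvg_cst.
- by apply: cvgMr_tmp; apply: cvgB => //; exact: cvg_cst.
Unshelve. all: by end_near. Qed.

Lemma bspline_cvg_left (R : realType) (Xi : seq R) q k (l := last 0 Xi) :
  nondecreasing_knots Xi -> (k + q.+1 < size Xi)%N ->
  bspline Xi q k y @[y --> l^'-] --> bspline Xi q k l.
Proof.
move=> ndXi; elim: q k => [|q IH] k kq.
  apply: cvg_near_cst => /=; rewrite addn1 in kq.
  have k1l : Xi`_k.+1 <= l.
    have s0 : (0 < size Xi)%N by exact: leq_ltn_trans kq.
    by rewrite /l -nth_last ndXi// -ltnS prednK// kq leqnn.
  rewrite ltNge k1l andbF/= eqxx andbT.
  have [k1E|k1l'] := eqVneq Xi`_k.+1 l.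
    rewrite k1E andbT.
    have [kl|lk] := ltP Xi`_k l.
      near=> y; suff -> : Xi`_k <= y < l by [].
      apply/andP; split.
        by apply/ltW; near: y; exact: nbhs_left_gt.
      by near: y; exact: nbhs_left_lt.
    near=> y; congr ((nat_of_bool _)%:R); apply/negbTE; rewrite negb_or !negb_and -ltNge -!leNgt.
    have yl : y < l by near: y; exact: nbhs_left_lt.
    by rewrite (lt_le_trans yl lk) (ltW (lt_le_trans yl lk)).
  rewrite andbF; near=> y; congr ((nat_of_bool _)%:R); apply/negbTE.
  rewrite negb_or !negb_and -ltNge -!leNgt.
  have yl : Xi`_k.+1 < y by near: y; apply: nbhs_left_gt; rewrite lt_neqAle k1l'.
  by rewrite (ltW yl) (gt_eqF yl) !orbT.
rewrite /=; have cx : y @[y --> l^'-] --> l by exact: cvg_at_left_filter.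
apply: cvgD; apply: cvgM; rewrite -/l.
- by apply: cvgMr_tmp; apply: cvgB => //; exact: cvg_cst.
- by apply: IH; rewrite (ltn_trans _ kq)// ltn_add2l.
- by apply: cvgMr_tmp; apply: cvgB => //; exact: cvg_cst.
- by apply: IH; rewrite addSnnS.
Unshelve. all: by end_near. Qed.

Lemma bspline_neq0_itv (R : realType) (Xi : seq R) q k x :
  nondecreasing_knots Xi -> (k + q.+1 < size Xi)%N -> bspline Xi q k x != 0 ->
  exists a b, a < b /\ forall y, a < y < b -> bspline Xi q k y != 0.
Proof.
move=> ndXi kq b0; have [xl|xl] := eqVneq x (last 0 Xi).
  have := @bspline_cvg_left _ _ q k ndXi kq.
  rewrite -xl => /cvgr_neq0 /(_ b0) /nbhs_ballP[e /= e0 H].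
  exists (x - e), x; split=> [|y /andP[xy yx]]; first by rewrite ltrBlDr ltrDl.
  by apply: H => //; rewrite /ball/= ltr_distl; lra.
have /cvgr_neq0 /(_ b0) /nbhs_ballP[e /= e0 H] := @bspline_cvg_right _ _ q k _ xl.
exists x, (x + e); split=> [|y /andP[xy yx]]; first by rewrite ltrDl.
by apply: H => //; rewrite /ball/= ltr_distl; lra.
Qed.

Lemma bspline_peak (R : realType) p n j (Xi : seq R) (e : R) :
  (0 < p)%N -> open_knot_vector p n Xi -> (j < n)%N -> e = 0 \/ e = 1 ->
  bspline Xi p j e != 0 ->
  exists lo hi, [/\ lo < hi, lo <= e <= hi,
    forall x, ~~ (lo <= x <= hi) -> bspline Xi p j x = 0,
    forall x, lo < x < hi -> bspline Xi p j x != 0 &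
    forall s t, e <= s <= t \/ t <= s <= e ->
      bspline Xi p j t <= bspline Xi p j s].
Proof.
move=> p0 hXi jn e01 be.
have [pn szXi [Xi0 Xi1 [Xip Xin] _ _]] := hXi.
have ndXi := open_knots_nondecreasing hXi.
have jsz : (j + p.+1 < size Xi)%N by rewrite szXi addnS ltnS ltn_add2r.
have b_ge0 x : 0 <= bspline Xi p j x by exact: bspline_ge0.
case: e01 => eE; rewrite {}eE in be *.
  have j0 : j = 0%N.
    have jp : (j + p <= n + p)%N by rewrite leq_add2r ltnW.
    by have /eqP := bspline_eq0_at0 hXi (leqnn p) jp be; rewrite -{2}[p]add0n eqn_add2r => /eqP.
  set L := Xi`_p.+1; have L0 : 0 < L by rewrite -[ltLHS](Xi0 p).
  have bE x : bspline Xi p j x = ((L - x) / L) ^+ p * bspline Xi 0 p x.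
    by apply: (bspline_first hXi); rewrite j0.
  have b0 x : ~~ (0 <= x < L) -> bspline Xi p j x = 0.
    rewrite bE /= (Xi0 p)// -/L => /negbTE ->/=.
    have [->|xL] := eqVneq x L; last by rewrite !andbF mulr0.
    by rewrite subrr mul0r expr0n eqn0Ngt p0 mul0r.
  have b1 x : 0 <= x < L -> bspline Xi p j x = ((L - x) / L) ^+ p.
    by rewrite bE /= (Xi0 p)// -/L => -> /=; rewrite mulr1.
  exists 0, L; split => // [|x xL|x /andP[x0 xL]|s t].
  - by rewrite lexx ltW.
  - by apply: b0; apply: contra xL => /andP[-> /ltW ->].
  - by rewrite b1 ?ltW// expf_neq0// mulf_neq0 ?invr_neq0 ?subr_eq0 ?gt_eqF.
  move=> [/andP[s0 st]|/andP[ts s0]]; last first.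
    have [t0|t0] := eqVneq t s; first by rewrite t0.
    rewrite [leLHS]b0 ?b_ge0// negb_and -ltNge (@lt_le_trans _ _ s)//.
    by rewrite lt_neqAle t0.
  have [tL|Lt] := ltP t L; last first.
    by rewrite [leLHS]b0 ?b_ge0// negb_and -!leNgt Lt orbT.
  rewrite !b1 ?s0 ?tL ?(le_lt_trans st) ?(le_trans s0)//.
  have iL : 0 <= L^-1 by rewrite invr_ge0 ltW.
  rewrite lerXn2r ?nnegrE ?mulr_ge0 ?subr_ge0 ?(ltW tL) ?(le_trans st (ltW tL))//.
  by rewrite ler_wpM2r// lerD2l lerN2.
have jE : j = n.-1.
  have jp : (j + p < n + p)%N by rewrite ltn_add2r.
  exact: (bspline_eq0_at1 hXi (leqnn p) jp).
have n0 : (0 < n)%N by exact: leq_trans pn.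
have X1 : Xi`_n = 1 by rewrite Xi1 ?leqnn ?leq_addr.
set l := Xi`_n.-1; have l1 : l < 1 by rewrite -X1.
have bE x : bspline Xi p j x = ((x - l) / (1 - l)) ^+ p * bspline Xi 0 n.-1 x.
  by rewrite jE; exact: (bspline_last hXi).
have b0E x : bspline Xi 0 n.-1 x = (l <= x <= 1)%R%:R.
  rewrite /= prednK// X1 -/l (open_knots_last hXi) andbb.
  have [->|x1] := eqVneq x 1; first by rewrite ltxx andbF l1 lexx ltW.
  by rewrite andbF orbF lt_neqAle x1.
have b0 x : ~~ (l <= x <= 1) -> bspline Xi p j x = 0.
  by rewrite bE b0E => /negbTE ->; rewrite mulr0.
have b1 x : l <= x <= 1 -> bspline Xi p j x = ((x - l) / (1 - l)) ^+ p.
  by rewrite bE b0E => ->; rewrite mulr1.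
exists l, 1; split => // [|x /andP[lx x1]|s t].
- by rewrite lexx ltW.
- rewrite b1 ?ltW// expf_neq0// mulf_neq0 ?invr_neq0 ?subr_eq0 ?(gt_eqF lx)//.
  by rewrite ?(gt_eqF l1).
move=> [/andP[s0 st]|/andP[ts s1]].
  have [->//|s1] := eqVneq s t.
  rewrite [leLHS]b0 ?b_ge0// negb_and -!ltNge; apply/orP; right.
  by apply: (le_lt_trans s0); rewrite lt_neqAle s1.
have [lt|tl] := leP l t; last first.
  by rewrite [leLHS]b0 ?b_ge0// negb_and -!ltNge tl.
rewrite !b1 ?s1 ?lt ?(le_trans ts) ?(le_trans lt)//.
have iL : 0 <= (1 - l)^-1 by rewrite invr_ge0 subr_ge0 ltW.
rewrite lerXn2r ?nnegrE ?mulr_ge0 ?subr_ge0 ?(le_trans lt ts)//.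
by rewrite ler_wpM2r// lerD2r.
Qed.

Section weighted_poincare.
Context (R : realType) (f df : R -> R).
Hypothesis fdf : forall t : R, is_derive t 1 f (df t).
Hypothesis cdf : continuous df.
Local Notation mu := (@lebesgue_measure R).

Lemma derivable1_continuous : continuous f.
Proof.
by move=> t; apply: differentiable_continuous; apply/derivable1_diffP; exact: ex_derive.
Qed.

Let mdf2 : measurable_fun setT (fun t : measurableTypeR R => df t ^+ 2).
Proof.
by apply: measurable_funX; exact: continuous_measurable_fun.
Qed.

Lemma sqr_increment_le (x y : R) : x <= y ->
  (((f y - f x) ^+ 2)%:E <=
   (y - x)%:E * \int[mu]_(t in `[x, y]) (df t ^+ 2)%:E)%E.
Proof.
rewrite le_eqVlt => /predU1P[->|xy].
  by rewrite !subrr expr0n mul0e.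
have yx0 : 0 < y - x by rewrite subr_gt0.
(* [0 <= (df - m) ^+ 2] is integrated as [2 m df - m ^+ 2 <= df ^+ 2], whose left
   side has the explicit antiderivative [H]. *)
set m := (f y - f x) / (y - x).
pose h t : R := 2 * m * df t - m ^+ 2.
pose H t : R := 2 * m * f t - m ^+ 2 * t.
have ch : continuous h.
  by move=> t; apply: cvgB; [apply: cvgM; [exact: cvg_cst|exact: cdf]|exact: cvg_cst].
have dH (t : R) : is_derive t 1 H (h t).
  apply: is_derive_eq => /=; rewrite /h; rewrite ![_ *: _]mulrC /=; ring.
have cH : continuous H.
  by move=> t; apply: differentiable_continuous; apply/derivable1_diffP; exact: ex_derive.
have hE : (\int[mu]_(t in `[x, y]) (h t)%:E = ((y - x) * m ^+ 2)%:E)%E.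
  rewrite (@continuous_FTC2 _ _ H)//.
  - rewrite -EFinB /H; congr EFin.
    have -> : f y = f x + m * (y - x) by rewrite /m divfK ?gt_eqF// addrC subrK.
    ring.
  - exact: continuous_subspaceT.
  - split => //; [exact/cvg_at_right_filter/cH|exact/cvg_at_left_filter/cH].
  - by move=> t _; rewrite derive1E; exact: derive_val.
have -> : (f y - f x) ^+ 2 = (y - x) * ((y - x) * m ^+ 2).
  by rewrite /m; field; rewrite gt_eqF.
rewrite EFinM lee_pmul2l// -hE; apply: le_integral => //.
- by apply: continuous_compact_integrable; [exact: segment_compact|exact: continuous_subspaceT].
- apply: continuous_compact_integrable; first exact: segment_compact.
  by apply: continuous_subspaceT => t; apply: cvgM; exact: cdf.
- move=> t _; rewrite lee_fin -subr_ge0.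
  by rewrite (_ : _ - _ = (df t - m) ^+ 2) ?sqr_ge0// /h; ring.
Qed.

Lemma weighted_poincare1 (w : R -> R) (lo hi e : R) :
  measurable_fun setT (w : measurableTypeR R -> R) ->
  (forall t, 0 <= w t) -> (forall t, ~~ (lo <= t <= hi) -> w t = 0) ->
  lo <= e <= hi ->
  (forall s t, e <= s <= t \/ t <= s <= e -> w t <= w s) ->
  (\int[mu]_t (f t ^+ 2 * w t)%:E <=
   (2 * (hi - lo))%:E * (f e ^+ 2 * w e)%:E +
   (2 * (hi - lo) ^+ 2)%:E * \int[mu]_t (df t ^+ 2 * w t)%:E)%E.
Proof.
move=> mw w0 wout /andP[loe ehi] wpeak.
have lohi : 0 <= hi - lo by rewrite subr_ge0 (le_trans loe).
set I := (\int[mu]_t (df t ^+ 2 * w t)%:E)%E.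
have mf : measurable_fun setT (fun t : measurableTypeR R => f t ^+ 2).
  by apply: measurable_funX; apply: continuous_measurable_fun; exact: derivable1_continuous.
have mfw : measurable_fun setT (fun t : measurableTypeR R => (f t ^+ 2 * w t)%:E).
  by apply/measurable_EFinP; exact: measurable_funM.
have mdfw : measurable_fun setT (fun t : measurableTypeR R => (df t ^+ 2 * w t)%:E).
  by apply/measurable_EFinP; exact: measurable_funM.
have I0 : (0 <= I)%E.
  by apply: integral_ge0 => t _; rewrite lee_fin mulr_ge0 ?sqr_ge0.
pose c := ((2 * (f e ^+ 2 * w e))%:E + (2 * (hi - lo))%:E * I)%E.
have incr t a b : lo <= a -> a <= b -> b <= hi -> 
    (forall s, a <= s <= b -> w t <= w s) ->
    (((f b - f a) ^+ 2 * w t)%:E <= (hi - lo)%:E * I)%E.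
  move=> loa ab bhi wts.
  rewrite EFinM; apply: (@le_trans _ _
    ((b - a)%:E * \int[mu]_(s in `[a, b]) (df s ^+ 2)%:E * (w t)%:E)%E).
    by apply: lee_wpmul2r; rewrite ?lee_fin//; exact: sqr_increment_le.
  rewrite -muleA; apply: lee_pmul; rewrite ?lee_fin ?subr_ge0//.
  - apply: mule_ge0; last by rewrite lee_fin.
    by apply: integral_ge0 => s _; rewrite lee_fin sqr_ge0.
  - by rewrite lerB.
  rewrite muleC -ge0_integralZl_EFin//; last first.
  - by apply/measurable_EFinP; exact: measurable_funTS.
  - by move=> s _; rewrite lee_fin sqr_ge0.
  apply: (@le_trans _ _ (\int[mu]_(s in `[a, b]) (df s ^+ 2 * w s)%:E)%E).
    apply: ge0_le_integral => //.
    - by move=> s _; rewrite lee_fin mulr_ge0// sqr_ge0.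
    - by apply/measurable_EFinP; apply: measurable_funM => //; exact: measurable_funTS.
    - exact: measurable_funTS.
    - move=> s /=; rewrite in_itv/= => sab; rewrite lee_fin mulrC ler_wpM2l ?sqr_ge0//.
      exact: wts.
  apply: ge0_subset_integral => //.
  by move=> s _; rewrite lee_fin mulr_ge0// sqr_ge0.
have key t : lo <= t <= hi -> ((f t ^+ 2 * w t)%:E <= c)%E.
  move=> /andP[lot thi].
  have wte : w t <= w e.
    by apply: wpeak; have [et|te] := leP e t; [left|right]; rewrite lexx// ltW.
  apply: (@le_trans _ _ ((2 * (f e ^+ 2 * w e))%:E + 2%:E * ((f t - f e) ^+ 2 * w t)%:E)%E).
    rewrite -EFinM -EFinD lee_fin.
    have h1 : f e ^+ 2 * w t <= f e ^+ 2 * w e by rewrite ler_wpM2l ?sqr_ge0.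
    have h2 : 0 <= (f t - 2 * f e) ^+ 2 * w t by rewrite mulr_ge0 ?sqr_ge0.
    nra.
  apply: leeD => //; rewrite [(2 * (hi - lo))%:E]EFinM -muleA; apply: lee_wpmul2l => //.
  have [et|/ltW te] := leP e t.
    by apply: incr => // s /andP[es st]; apply: wpeak; left; rewrite es.
  rewrite -sqrrN opprB.
  by apply: incr => // s /andP[es st]; apply: wpeak; right; rewrite es.
apply: (@le_trans _ _ (\int[mu]_(t in `[lo, hi]) c)%E).
  have <- : (\int[mu]_(t in `[lo, hi]) (f t ^+ 2 * w t)%:E =
             \int[mu]_t (f t ^+ 2 * w t)%:E)%E.
    rewrite integral_mkcond; apply: eq_integral => t _; rewrite patchE.
    case: ifPn => // /negP tl; rewrite wout ?mulr0//.
    by apply/negP => h; apply: tl; apply: mem_set; rewrite /= in_itv.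
  apply: ge0_le_integral => //.
  - by move=> t _; rewrite lee_fin mulr_ge0// sqr_ge0.
  - exact: measurable_funTS.
rewrite [X in (X <= _)%E](_ : _ = c * mu `[lo, hi])%E; last first.
  by rewrite -(@integral_cst _ _ _ mu).
rewrite lebesgue_measure_itv/= lte_fin.
have -> : (if (lo < hi)%R then hi%:E - lo%:E else 0)%E = (hi - lo)%:E.
  case: ltP => // hl; congr EFin; apply/esym/eqP.
  by rewrite eq_le lohi andbT subr_le0.
rewrite /c muleC ge0_muleDr; last 2 first.
- by rewrite lee_fin mulr_ge0// mulr_ge0// sqr_ge0.
- by rewrite mule_ge0// lee_fin mulr_ge0.
rewrite -EFinM muleA -!EFinM.
rewrite (_ : (hi - lo) * (2 * (hi - lo)) = 2 * (hi - lo) ^+ 2); last by ring.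
by rewrite (_ : (hi - lo) * (2 * _) = 2 * (hi - lo) * (f e ^+ 2 * w e))//; ring.
Qed.

End weighted_poincare.

Lemma le_measure_integral d (T : measurableType d) (R : realType)
    (m1 m2 : {measure set T -> \bar R}) (D : set T) (f : T -> \bar R) :
  (forall A, measurable A -> (m1 A <= m2 A)%E) -> (forall x, D x -> (0 <= f x)%E) ->
  (\int[m1]_(x in D) f x <= \int[m2]_(x in D) f x)%E.
Proof.
move=> m12 f0; rewrite !ge0_integralE//; apply: ge_ereal_sup => _ [h hf <-].
apply: (le_trans (le_measure_sintegral m12 h)).
by apply: ereal_sup_ubound; exists h.
Qed.

Lemma rV_insertD (R : realType) (n : nat) (i : 'I_n.+1) (h t : R) (y : 'rV[R]_n) :
  rV_insert i (h + t) y = h *: delta_mx 0 i + rV_insert i t y.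
Proof.
apply/rowP => k; rewrite !mxE; case: unliftP => [l ->|->]/=.
  by rewrite eq_sym (negbTE (neq_lift _ _)) mulr0 add0r.
by rewrite eqxx mulr1.
Qed.

Lemma rV_insert_coord (R : realType) (n : nat) (i : 'I_n.+1) (x : 'rV[R]_n.+1) :
  rV_insert i (x 0 i) (\row_k x 0 (lift i k)) = x.
Proof.
by apply/rowP => k; rewrite mxE; case: unliftP => [l ->|->]//=; rewrite mxE.
Qed.

Lemma continuous_rV_insert (R : realType) (n : nat) (i : 'I_n.+1) (y : 'rV[R]_n) :
  continuous (fun t : R => rV_insert i t y).
Proof.
move=> t; rewrite (_ : (fun t => _) = fun t : R => t *: delta_mx 0 i + rV_insert i 0 y).
  by apply: cvgD; [apply: cvgZr_tmp; exact: cvg_id|exact: cvg_cst].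
by apply/funext => s; rewrite -rV_insertD addr0.
Qed.

Lemma is_derive_rV_insert (R : realType) (n : nat) (i : 'I_n.+1) (y : 'rV[R]_n)
    (f : 'rV[R]_n.+1 -> R) (t : R) : differentiable f (rV_insert i t y) ->
  is_derive t 1 (fun t : R => f (rV_insert i t y)) (partial i f (rV_insert i t y)).
Proof.
move=> df; have := diff_derivable (v := delta_mx 0 i) df.
set g := fun t : R => _.
have gE : (fun h : R => h^-1 *: ((g \o shift t) (h *: 1) - g t)) =
  (fun h : R => h^-1 *: ((f \o shift (rV_insert i t y)) (h *: delta_mx 0 i) - f (rV_insert i t y))).
  by apply/funext => h; rewrite /g /= [h *: 1]mulr1 rV_insertD.
move=> dfi; split; first by rewrite /derivable gE.
by rewrite /partial /derive gE.
Qed.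

Section unit_cube_surface_facts.
Context (R : realType) (n : nat).

Lemma hyperplane_measure_le_surface (i : 'I_n.+1) (e : R) (A : set 'rV[R]_n.+1) :
  e = 0 \/ e = 1 -> (hyperplane_measure i e A <= unit_cube_surface A)%E.
Proof.
move=> e01; rewrite /unit_cube_surface (bigD1 i)//=.
apply: (@le_trans _ _ (hyperplane_measure i 0 A + hyperplane_measure i 1 A)%E).
  by case: e01 => ->; [rewrite leeDl|rewrite leeDr].
by rewrite leeDl// sume_ge0// => k _; rewrite adde_ge0.
Qed.

End unit_cube_surface_facts.

Section weighted_poincare_slices.
Context (R : realType) (n : nat) (i : 'I_n.+1).
Context (rho phi : 'rV[R]_n.+1 -> R) (lo hi e : R).
Hypothesis mrho : measurable_fun setT rho.
Hypothesis rho0 : forall x, 0 <= rho x.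
Hypothesis rho_out : forall x : 'rV[R]_n.+1, ~~ (lo <= x 0 i <= hi) -> rho x = 0.
Hypothesis ehi : lo <= e <= hi.
Hypothesis rho_peak : forall y s t, e <= s <= t \/ t <= s <= e ->
  rho (rV_insert i t y) <= rho (rV_insert i s y).
Hypothesis dphi : forall x, differentiable phi x.
Hypothesis cphi : continuous (partial i phi).
Local Notation mu := (lebesgue_rV R n.+1).

Lemma weighted_poincare_slices :
  (\int[mu]_x (phi x ^+ 2 * rho x)%:E <=
   (2 * (hi - lo))%:E * \int[lebesgue_rV R n]_y
      (phi (rV_insert i e y) ^+ 2 * rho (rV_insert i e y))%:E +
   (2 * (hi - lo) ^+ 2)%:E * \int[mu]_x (partial i phi x ^+ 2 * rho x)%:E)%E.
Proof.
have mphi : measurable_fun setT phi.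
  by apply: continuous_measurable_rV => x; exact: differentiable_continuous.
have mf : measurable_fun setT (fun x : 'rV[R]_n.+1 => (phi x ^+ 2 * rho x)%:E).
  by apply/measurable_EFinP; apply: measurable_funM => //; exact: measurable_funX.
have mdf : measurable_fun setT (fun x : 'rV[R]_n.+1 => (partial i phi x ^+ 2 * rho x)%:E).
  apply/measurable_EFinP; apply: measurable_funM => //; apply: measurable_funX.
  exact: continuous_measurable_rV.
have ge0 (u : 'rV[R]_n.+1 -> R) x : (0 <= (u x ^+ 2 * rho x)%:E)%E.
  by rewrite lee_fin mulr_ge0// sqr_ge0.
have lohi : 0 <= hi - lo by case/andP: ehi => h1 h2; rewrite subr_ge0 (le_trans h1).
rewrite (integral_rV_insert i)// (integral_rV_insert i mdf)//.
have mins : measurable_fun setT (fun y : 'rV[R]_n => rV_insert i e y).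
  by apply: measurable_rV_insert; [exact: measurable_cst|exact: measurable_id].
have mG (f : 'rV[R]_n.+1 -> \bar R) : measurable_fun setT f -> (forall x, 0 <= f x)%E ->
    measurable_fun setT (fun y => \int[@lebesgue_measure R]_t f (rV_insert i t y))%E.
  move=> mff f0; apply: (@measurable_fun_fubini_tonelli_G _ _ _ _ _ (@lebesgue_measure R)
    (fun ty : measurableTypeR R * 'rV[R]_n => f (rV_insert i ty.1 ty.2))) => //.
  by apply: measurableT_comp => //; exact: measurable_rV_insert.
have mA := mG _ mf (ge0 phi).
have mB : measurable_fun setT (fun y => (phi (rV_insert i e y) ^+ 2 * rho (rV_insert i e y))%:E).
  exact: (measurableT_comp mf).
have mC := mG _ mdf (ge0 (partial i phi)).
have c1 : 0 <= 2 * (hi - lo) by rewrite mulr_ge0.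
have c2 : 0 <= 2 * (hi - lo) ^+ 2 by rewrite mulr_ge0// exprn_ge0.
rewrite -!ge0_integralZl_EFin//; last by move=> y _; exact: integral_ge0.
rewrite -ge0_integralD//; last 4 first.
- by move=> y _; rewrite mule_ge0// lee_fin.
- exact: measurable_funeM.
- by move=> y _; rewrite mule_ge0 ?lee_fin//; exact: integral_ge0.
- exact: measurable_funeM.
apply: ge0_le_integral => //.
- by move=> y _; exact: integral_ge0.
- by apply: emeasurable_funD; exact: measurable_funeM.
move=> y _.
apply: (@weighted_poincare1 _ (fun t => phi (rV_insert i t y))
  (fun t => partial i phi (rV_insert i t y)) _ _
  (fun t => rho (rV_insert i t y)) lo hi e) => //.
- by move=> t; exact: is_derive_rV_insert.
- by move=> t; apply: continuous_comp; [exact: continuous_rV_insert|exact: cphi].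
- apply: measurableT_comp => //.
  by apply: measurable_rV_insert; [exact: measurable_id|exact: measurable_cst].
- by move=> t tlh; apply: rho_out; rewrite mxE unlift_none.
- by move=> s t; exact: rho_peak.
Qed.

End weighted_poincare_slices.

Section unit_cube_facts.
Context (R : realType) (n : nat).

Lemma closed_unit_cube : closed (@unit_cube R n).
Proof.
rewrite (_ : @unit_cube R n = \bigcap_(i in [set: 'I_n])
    ((fun x : 'rV[R]_n => x 0 i) @^-1` `[0, 1]%classic)).
  apply: closed_bigI => i _; apply: closed_comp; last exact: itv_closed.
  by move=> x _; exact: coord_continuous.
apply/seteqP; split=> x /= xP i.
  by move=> _; rewrite /= in_itv; exact: xP.
by have := xP i I; rewrite /= in_itv.
Qed.

Lemma boundary_unit_cubeP (x : 'rV[R]_n) : boundary (@unit_cube R n) x ->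
  exists i, x 0 i = 0 \/ x 0 i = 1.
Proof.
move=> [xcl xint]; have xC : unit_cube x.
  by move: xcl; rewrite -((closure_id _).1 closed_unit_cube).
apply: contrapT => /forallNP H; apply: xint; rewrite /interior.
exists (fun _ j => `]0, 1[%classic) => [k j|y /= yP i].
  rewrite ord1; apply: near_in_itvoo; rewrite in_itv/=.
  have [h0 h1] : x 0 j <> 0 /\ x 0 j <> 1.
    by split => h; apply: (H j); [left|right].
  have /andP[x0 x1] := xC j.
  by rewrite !lt_neqAle x0 x1 !andbT eq_sym; apply/andP; split; exact/eqP.
by have := yP 0 i; rewrite in_itv/= => /andP[/ltW -> /ltW ->].
Qed.

Lemma enorm_ge_coord (x : 'rV[R]_n) i : `|x 0 i| <= enorm x.
Proof.
rewrite -sqrtr_sqr /enorm ler_wsqrtr// (bigD1 i)//= lerDl sumr_ge0// => k _.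
exact: sqr_ge0.
Qed.

Lemma enorm_ge0 (x : 'rV[R]_n) : 0 <= enorm x. Proof. exact: sqrtr_ge0. Qed.

Lemma enorm_le_ediam (A : set 'rV[R]_n) x y : A `<=` @unit_cube R n ->
  A x -> A y -> enorm (x - y) <= ediam A.
Proof.
move=> AC Ax Ay; apply: ub_le_sup; last by exists x, y.
exists (Num.sqrt (\sum_(i < n) 1)) => _ [u [v [Au Av ->]]].
apply: ler_wsqrtr; apply: ler_sum => i _; rewrite !mxE.
have /andP[u0 u1] := AC _ Au i; have /andP[v0 v1] := AC _ Av i.
rewrite -subr_ge0 -[1](expr1n _ 2) subr_sqr mulr_ge0//; lra.
Qed.

End unit_cube_facts.

Lemma rV_insert_lt_lebesgue_gt0 (R : realType) (n : nat) (a b : 'I_n -> R) :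
  (forall k, a k < b k) ->
  measurable [set y : 'rV[R]_n | forall k, a k < y 0 k < b k] /\
  (0 < lebesgue_rV R n [set y | forall k, (a k < y 0 k < b k)%R])%E.
Proof.
elim: n a b => [|n IH] a b ab.
  rewrite (_ : [set y | _] = setT); last by apply/seteqP; split => // y _ [].
  split; first exact: measurableT.
  rewrite [X in (0 < X)%E](_ : _ = 1%E) ?lte01//=.
  by rewrite /dirac indicE mem_set// => -[].
have [mA A0] := IH (fun k => a (lift ord0 k)) (fun k => b (lift ord0 k)) (fun k => ab _).
set A := [set y | _] in mA A0; set B := [set y | _].
have mB : measurable B.
  rewrite (_ : B = \bigcap_(k in [set: 'I_n.+1]) ((fun x : 'rV[R]_n.+1 => x 0 k) @^-1`
      `](a k), (b k)[)).
    apply: fin_bigcap_measurable => // k _.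
    by have := @measurable_coord R n.+1 k measurableT _
         (measurable_itv `](a k), (b k)[); rewrite setTI.
  apply/seteqP; split => x /= xP k; first by move=> _; rewrite /= in_itv; exact: xP.
  by have := xP k I; rewrite /= in_itv.
split => //; rewrite /= /lebesgue_cons /pushforward.
rewrite (_ : _ @^-1` B = `](a ord0), (b ord0)[%classic `*` A).
  rewrite product_measure1E//; apply: mule_gt0 => //.
  rewrite [X in (0 < X)%E](_ : _ = lebesgue_measure `](a ord0), (b ord0)[%classic)//.
  by rewrite lebesgue_measure_itv/= lte_fin ab lte_fin subr_gt0.
apply/seteqP; split => [[t y] /= H|[t y] /= [H1 H2] k].
  split; first by have := H ord0; rewrite mxE unlift_none/= in_itv.
  by move=> k; have := H (lift ord0 k); rewrite mxE liftK.
rewrite mxE; case: (unliftP ord0 k) => [l ->|->]/=; first exact: H2.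
by rewrite in_itv in H1.
Qed.

Section tensor_bspline_facts.
Context (R : realType) (d : nat) (p n : 'I_d.+1 -> nat) (Xi : 'I_d.+1 -> seq R).
Context (j : 'I_d.+1 -> nat).
Hypothesis hp : forall i, (1 <= p i)%N.
Hypothesis hXi : forall i, open_knot_vector (p i) (n i) (Xi i).
Hypothesis hj : forall i, (j i < n i)%N.
Local Notation b i := (bspline (Xi i) (p i) (j i)).
Local Notation beta := (tensor_bspline p Xi j).
Local Notation omega := (supp beta).
Local Notation Gamma := (boundary (@unit_cube R d.+1) `&` boundary omega).

Let jsz i : (j i + (p i).+1 < size (Xi i))%N.
Proof. by have [_ -> _] := hXi i; rewrite addnS ltnS ltn_add2r. Qed.

Let ndXi i : nondecreasing_knots (Xi i).
Proof. exact: open_knots_nondecreasing (hXi i). Qed.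

Lemma tensor_bspline_ge0 x : 0 <= beta x.
Proof. by apply: prodr_ge0 => i _; exact: bspline_ge0. Qed.

Lemma measurable_tensor_bspline : measurable_fun setT (beta : 'rV[R]_d.+1 -> R).
Proof.
apply: measurable_prod => i _.
exact: (measurableT_comp (measurable_bspline (Xi i) (p i) (j i)) (measurable_coord i)).
Qed.

Lemma tensor_bspline_neq0 x k : beta x != 0 -> b k (x 0 k) != 0.
Proof. by move=> /prodf_neq0; exact. Qed.

Lemma tensor_bspline_unit_cube x : beta x != 0 -> unit_cube x.
Proof.
move=> /prodf_neq0 bx i.
have /andP[h1 h2] := bspline_itv (@ndXi i) (jsz i) (bx i isT).
have jnp : (j i + (p i).+1 <= n i + p i)%N by rewrite addnS ltn_add2r.
rewrite (le_trans _ h1) ?(le_trans h2)//.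
  exact: (open_knots_le1 (hXi i)).
by apply: (open_knots_ge0 (hXi i)); rewrite (leq_trans _ jnp)// leq_addr.
Qed.

Lemma supp_tensor_bspline_unit_cube : omega `<=` @unit_cube R d.+1.
Proof.
rewrite ((closure_id _).1 (@closed_unit_cube R d.+1)).
by apply: closure_subset => x; exact: tensor_bspline_unit_cube.
Qed.

Lemma measurable_supp_tensor_bspline : measurable omega.
Proof. by apply: closed_measurable_rV; exact: closed_closure. Qed.

Lemma measurable_boundary (A : set 'rV[R]_d.+1) : measurable (boundary A).
Proof.
apply: measurableD; first by apply: closed_measurable_rV; exact: closed_closure.
by apply: open_measurable_rV; exact: open_interior.
Qed.

Lemma tensor_bspline_insert i t y : beta (rV_insert i t y) =
  b i t * \prod_(k < d) b (lift i k) (y 0 k).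
Proof.
rewrite /tensor_bspline (bigD1_ord i)//= mxE unlift_none; congr (_ * _).
by apply: eq_bigr => k _; rewrite mxE liftK.
Qed.

Lemma tensor_bspline_boundary x : boundary (@unit_cube R d.+1) x -> beta x != 0 ->
  exists i e lo hi, [/\ e = 0 \/ e = 1, x 0 i = e, lo < hi, lo <= e <= hi &
    [/\ forall t, ~~ (lo <= t <= hi) -> b i t = 0,
      forall t, lo < t < hi -> b i t != 0 &
      forall s t, e <= s <= t \/ t <= s <= e -> b i t <= b i s]].
Proof.
move=> /boundary_unit_cubeP[i xi] /prodf_neq0/(_ i isT) bx.
have [lo [hi [h1 h2 h3 h4 h5]]] := bspline_peak (hp i) (hXi i) (hj i) xi bx.
by exists i, (x 0 i), lo, hi; split.
Qed.

Lemma face_subset_Gamma (i : 'I_d.+1) (x : 'rV[R]_d.+1) :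
  x 0 i = 0 \/ x 0 i = 1 -> beta x != 0 -> Gamma x.
Proof.
move=> xi bx; have xC := tensor_bspline_unit_cube bx.
have xint : ~ (@unit_cube R d.+1)° x.
  rewrite /interior -(rV_insert_coord i x); set y := \row_k _.
  move=> /(continuous_rV_insert (y := y)) /nbhs_ballP[e /= e0 H].
  have e2 : `|e / 2| < e by rewrite gtr0_norm ?divr_gt0// ltr_pdivrMr// ltr_pMr// ltr1n.
  case: xi => xi.
    have := H (- (e / 2)); rewrite /ball/= xi add0r opprK => /(_ e2) /(_ i).
    by rewrite mxE unlift_none/= => /andP[+ _]; rewrite oppr_ge0 leNgt divr_gt0.
  have := H (1 + e / 2); rewrite /ball/= xi opprD addrA subrr add0r normrN.
  move=> /(_ e2) /(_ i).
  by rewrite mxE unlift_none/= => /andP[_]; rewrite gerDl leNgt divr_gt0.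
split; first by split=> //; exact: subset_closure.
split; first by do 2 apply: subset_closure.
by move=> /(interiorS supp_tensor_bspline_unit_cube).
Qed.

Lemma unit_cube_surface_Gamma_gt0 x : boundary (@unit_cube R d.+1) x ->
  beta x != 0 -> (0 < unit_cube_surface Gamma)%E.
Proof.
move=> xC bx; have [i xi] := boundary_unit_cubeP xC.
apply: (@lt_le_trans _ _ (hyperplane_measure i (x 0 i) Gamma)); last first.
  exact: hyperplane_measure_le_surface.
have /choice[a] (k : 'I_d) : exists a, exists c, a < c /\
    forall y, a < y < c -> b (lift i k) y != 0.
  apply: (bspline_neq0_itv (@ndXi _) (jsz _)).
  exact: (tensor_bspline_neq0 _ bx).
move=> /choice[c ac].
have [mB B0] := rV_insert_lt_lebesgue_gt0 (fun k => (ac k).1).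
apply: (lt_le_trans B0); apply: le_measure; rewrite ?inE//.
  have mi : measurable_fun setT (fun y : 'rV[R]_d => rV_insert i (x 0 i) y).
    by apply: measurable_rV_insert; [exact: measurable_cst|exact: measurable_id].
  rewrite -[X in measurable X]setTI; apply: mi => //.
  by apply: measurableI; exact: measurable_boundary.
move=> y By; apply: (@face_subset_Gamma i).
  by rewrite mxE unlift_none.
rewrite tensor_bspline_insert mulf_neq0//; first exact: (tensor_bspline_neq0 _ bx).
by apply/prodf_neq0 => k _; apply: (ac k).2; exact: By.
Qed.

Lemma peak_interval_le_ediam i x lo hi : beta x != 0 -> lo < hi ->
  (forall t, lo < t < hi -> b i t != 0) -> hi - lo <= ediam omega.
Proof.
move=> bx lohi bi; apply/ler_addgt0Pr => e e0.
pose dl := Num.min e (hi - lo) / 4.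
have mn0 : 0 < Num.min e (hi - lo) by rewrite lt_min e0 subr_gt0.
have [dle dlh] : dl * 4 <= e /\ dl * 4 <= hi - lo.
  by rewrite /dl divfK ?pnatr_eq0//; split; rewrite ge_min lexx ?orbT.
have dl0 : 0 < dl by rewrite divr_gt0.
pose y := \row_k x 0 (lift i k).
have om t : lo < t < hi -> omega (rV_insert i t y).
  move=> /bi bt; apply: subset_closure; rewrite /= tensor_bspline_insert mulf_neq0//.
  by apply/prodf_neq0 => k _; rewrite mxE; exact: (tensor_bspline_neq0 _ bx).
apply: (@le_trans _ _ (enorm (rV_insert i (hi - dl) y - rV_insert i (lo + dl) y) + e)).
  have := enorm_ge_coord (rV_insert i (hi - dl) y - rV_insert i (lo + dl) y) i.
  rewrite !mxE !unlift_none /= => /(le_trans (ler_norm _)); lra.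
rewrite lerD2r; apply: enorm_le_ediam; first exact: supp_tensor_bspline_unit_cube.
  by apply: om; apply/andP; split; lra.
by apply: om; apply/andP; split; lra.
Qed.

End tensor_bspline_facts.

Lemma L2norm_sqrte (R : realType) d (m : {measure set 'rV[R]_d -> \bar R})
    (A : set 'rV[R]_d) (rho u : 'rV[R]_d -> R) : (forall x, 0 <= rho x) ->
  L2norm m A rho u = sqrte (\int[m]_(x in A) (`|u x| ^+ 2 * rho x)%:E).
Proof.
move=> rho0; rewrite /L2norm poweR12_sqrt//; apply: integral_ge0 => x _.
by rewrite lee_fin mulr_ge0.
Qed.

Lemma sqrte_lt_sqrt (R : realType) (x : \bar R) (e : R) :
  (0 <= x)%E -> (sqrte x < (Num.sqrt e)%:E)%E -> (x <= e%:E)%E.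
Proof.
case: x => [r| |] //=; rewrite !lee_fin lte_fin => r0.
have [e0|e0] := leP e 0.
  by rewrite (ler0_sqrtr e0) ltNge sqrtr_ge0.
by rewrite ltr_sqrt// => /ltW.
Qed.

Section tensor_poincare.
Context (R : realType) (d : nat) (p n : 'I_d.+1 -> nat) (Xi : 'I_d.+1 -> seq R).
Context (j : 'I_d.+1 -> nat).
Hypothesis hp : forall i, (1 <= p i)%N.
Hypothesis hXi : forall i, open_knot_vector (p i) (n i) (Xi i).
Hypothesis hj : forall i, (j i < n i)%N.
Local Notation b i := (bspline (Xi i) (p i) (j i)).
Local Notation beta := (tensor_bspline p Xi j).
Local Notation omega := (supp beta).
Local Notation Gamma := (boundary (@unit_cube R d.+1) `&` boundary omega).

Lemma integral_supp_tensor_bspline (u : 'rV[R]_d.+1 -> R) :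
  (\int[lebesgue_rV R d.+1]_(x in omega) (`|u x| ^+ 2 * beta x)%:E =
   \int[lebesgue_rV R d.+1]_x (u x ^+ 2 * beta x)%:E)%E.
Proof.
rewrite integral_mkcond; apply: eq_integral => x _; rewrite patchE.
rewrite real_normK ?num_real//; case: ifPn => // /negP xo.
have [->|bx] := eqVneq (beta x) 0; first by rewrite mulr0.
by exfalso; apply: xo; apply: mem_set; exact: subset_closure.
Qed.

Lemma tensor_poincare_smooth x : boundary (@unit_cube R d.+1) x -> beta x != 0 ->
  exists i, exists2 L, 0 <= L <= ediam omega & forall phi, smooth phi ->
    (\int[lebesgue_rV R d.+1]_(x in omega) (`|phi x| ^+ 2 * beta x)%:E <=
     (2 * L)%:E * \int[@unit_cube_surface R d]_(x in Gamma) (`|phi x| ^+ 2 * beta x)%:E +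
     (2 * L ^+ 2)%:E *
       \int[lebesgue_rV R d.+1]_(x in omega) (`|partial i phi x| ^+ 2 * beta x)%:E)%E.
Proof.
move=> xC bx.
have [i [e [lo [hi [e01 xie lohi ehi [bout bin bpeak]]]]]] :=
  tensor_bspline_boundary hp hXi hj xC bx.
have b0 := tensor_bspline_ge0 hXi hj.
exists i, (hi - lo).
  by rewrite subr_ge0 ltW//= (peak_interval_le_ediam hXi hj bx lohi bin).
move=> phi sphi.
have dphi y : differentiable phi y by exact: (sphi [::]).
have cdphi : continuous (partial i phi).
  by move=> y; apply: differentiable_continuous; exact: (sphi [:: i]).
have mb := measurable_tensor_bspline p Xi j.
have mphi : measurable_fun setT phi.
  by apply: continuous_measurable_rV => y; exact: differentiable_continuous.
have mf : measurable_fun setT (fun x : 'rV[R]_d.+1 => (`|phi x| ^+ 2 * beta x)%:E).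
  apply/measurable_EFinP; apply: measurable_funM => //; apply: measurable_funX.
  exact: measurableT_comp.
rewrite !integral_supp_tensor_bspline.
apply: (le_trans (weighted_poincare_slices mb b0 _ ehi _ dphi cdphi)).
- move=> y yo; apply/eqP/contraT => /(tensor_bspline_neq0 i).
  by rewrite bout ?eqxx.
- move=> y s t st; rewrite !tensor_bspline_insert ler_wpM2r ?bpeak//.
  apply: prodr_ge0 => k _; apply: bspline_ge0.
    exact: open_knots_nondecreasing (hXi _).
  by have [_ -> _] := hXi (lift i k); rewrite addnS ltnS ltn_add2r.
apply: leeD => //; apply: lee_wpmul2l.
  by rewrite lee_fin mulr_ge0// subr_ge0 ltW.
have f0 y : (0 <= (`|phi y| ^+ 2 * beta y)%:E)%E by rewrite lee_fin mulr_ge0.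
apply: (@le_trans _ _ (\int[hyperplane_measure i e]_(x in Gamma) (`|phi x| ^+ 2 * beta x)%:E)%E);
  last first.
  apply: le_measure_integral => // A _; exact: hyperplane_measure_le_surface.
have mG : measurable Gamma by apply: measurableI; exact: measurable_boundary.
have mi : measurable_fun setT (fun y : 'rV[R]_d => rV_insert i e y).
  by apply: measurable_rV_insert; [exact: measurable_cst|exact: measurable_id].
rewrite [leRHS]integral_mkcond [leRHS](@ge0_integral_pushforward _ _ _ _ R _ mi)//; last first.
- by move=> y _; rewrite patchE; case: ifP.
- by apply: (iffLR (measurable_restrictT _ mG)); exact: (measurable_funTS mf).
rewrite preimage_setT le_eqVlt; apply/orP; left; apply/eqP.
apply: eq_integral => y _; rewrite /= patchE real_normK ?num_real//.
case: ifPn => // /negP yG.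
have [->|by0] := eqVneq (beta (rV_insert i e y)) 0; first by rewrite mulr0.
exfalso; apply: yG; apply: mem_set; apply: (face_subset_Gamma hXi hj (i := i)) => //.
by rewrite mxE unlift_none.
Qed.

End tensor_poincare.

Lemma measurable_enorm (R : realType) (n : nat) d (T : measurableType d) (A : set T)
    (h : T -> 'rV[R]_n) : (forall i, measurable_fun A (fun x => h x 0 i)) ->
  measurable_fun A (fun x => enorm (h x)).
Proof.
move=> mh; apply: (measurableT_comp (continuous_measurable_fun (@sqrt_continuous R))).
by apply: measurable_sum => i; exact: measurable_funX.
Qed.

Lemma integral_sqr_le2 d (T : measurableType d) (R : realType)
    (mu : {measure set T -> \bar R}) (A : set T) (rho a b c : T -> R) :
  measurable A -> (forall x, 0 <= rho x) -> measurable_fun A rho ->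
  measurable_fun A a -> measurable_fun A b -> measurable_fun A c ->
  (forall x, `|a x| ^+ 2 <= 2 * `|b x| ^+ 2 + 2 * `|c x| ^+ 2) ->
  (\int[mu]_(x in A) (`|a x| ^+ 2 * rho x)%:E <=
   2%:E * \int[mu]_(x in A) (`|b x| ^+ 2 * rho x)%:E +
   2%:E * \int[mu]_(x in A) (`|c x| ^+ 2 * rho x)%:E)%E.
Proof.
move=> mA rho0 mrho ma mb mc abc.
have m (u : T -> R) : measurable_fun A u ->
    measurable_fun A (fun x => (`|u x| ^+ 2 * rho x)%:E).
  move=> mu'; apply/measurable_EFinP; apply: measurable_funM => //.
  by apply: measurable_funX; exact: measurableT_comp.
have ge0 (u : T -> R) x : A x -> (0 <= (`|u x| ^+ 2 * rho x)%:E)%E.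
  by move=> _; rewrite lee_fin mulr_ge0.
rewrite -!ge0_integralZl_EFin//; [|exact: ge0|exact: m|exact: ge0|exact: m].
rewrite -ge0_integralD//; last 4 first.
- by move=> x Ax; rewrite mule_ge0// ge0.
- by apply: measurable_funeM; exact: m.
- by move=> x Ax; rewrite mule_ge0// ge0.
- by apply: measurable_funeM; exact: m.
apply: ge0_le_integral => //.
- exact: ge0.
- exact: m.
- by apply: emeasurable_funD; apply: measurable_funeM; exact: m.
- move=> x _; rewrite -!EFinM -EFinD lee_fin.
  by apply: (le_trans (ler_wpM2r (rho0 x) (abc x))); rewrite mulrDl !mulrA.
Qed.

Lemma cvge0_sqrte_le (R : realType) (u : (\bar R)^nat) (e : R) : 0 < e ->
  (forall k, (0 <= u k)%E) -> sqrte (u k) @[k --> \oo] --> 0%E ->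
  \forall k \near \oo, (u k <= e%:E)%E.
Proof.
move=> e0 u0 u_cvg; have se0 : 0 < Num.sqrt e by rewrite sqrtr_gt0.
have u_lt : \forall k \near \oo, (sqrte (u k) < (Num.sqrt e)%:E)%E.
  exact: (u_cvg _ (nbhs_open_ereal_lt (f := fun=> Num.sqrt e) se0)).
near=> k; apply: sqrte_lt_sqrt; first exact: u0.
by near: k; exact: u_lt.
Unshelve. all: by end_near. Qed.

Lemma trace_zero_poincare (R : realType) (n : nat) (m : {measure set 'rV[R]_n -> \bar R})
    (A G : set 'rV[R]_n) (rho v : 'rV[R]_n -> R) (g : 'rV[R]_n -> 'rV[R]_n)
    (i : 'I_n) (L : R) :
  measurable A -> (forall x, 0 <= rho x) -> measurable_fun A rho -> 0 <= L ->
  measurable_fun A v -> (forall i, measurable_fun A (fun x => g x 0 i)) ->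
  (forall phi, smooth phi ->
    (\int[lebesgue_rV R n]_(x in A) (`|phi x| ^+ 2 * rho x)%:E <=
     (2 * L)%:E * \int[m]_(x in G) (`|phi x| ^+ 2 * rho x)%:E +
     (2 * L ^+ 2)%:E *
       \int[lebesgue_rV R n]_(x in A) (`|partial i phi x| ^+ 2 * rho x)%:E)%E) ->
  is_trace m A rho G v g (fun=> 0) ->
  (\int[lebesgue_rV R n]_(x in A) (`|enorm (g x)| ^+ 2 * rho x)%:E < +oo)%E ->
  (\int[lebesgue_rV R n]_(x in A) (`|v x| ^+ 2 * rho x)%:E <=
   (8 * L ^+ 2)%:E *
     \int[lebesgue_rV R n]_(x in A) (`|enorm (g x)| ^+ 2 * rho x)%:E)%E.
Proof.
move=> mA rho0 mrho L0 mv mg poinc [phi [sphi phiv phig phi0]] gfin.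
have N0 (m' : {measure set 'rV[R]_n -> \bar R}) (D : set 'rV[R]_n) (u : 'rV[R]_n -> R) :
    (0 <= \int[m']_(x in D) (`|u x| ^+ 2 * rho x)%:E)%E.
  by apply: integral_ge0 => x _; rewrite lee_fin mulr_ge0.
apply/lee_addgt0Pr => e e0.
pose K : R := 2 + 4 * L + 8 * L ^+ 2.
have K0 : 0 < K.
  by rewrite /K -addrA ltr_wpDr// addr_ge0 ?mulr_ge0// sqr_ge0.
have dl0 : 0 < e / K by rewrite divr_gt0.
move: phiv phig phi0.
under eq_fun do rewrite L2norm_sqrte//.
move=> /(cvge0_sqrte_le dl0 (fun k => N0 _ _ _)) phiv.
under eq_fun do rewrite L2norm_sqrte//.
move=> /(cvge0_sqrte_le dl0 (fun k => N0 _ _ _)) phig.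
under eq_fun do rewrite L2norm_sqrte//.
move=> /(cvge0_sqrte_le dl0 (fun k => N0 _ _ _)) phi0.
have [k [phivk [phigk phi0k]]] := filter_ex (filterI phiv (filterI phig phi0)).
have dphi y : differentiable (phi k) y by exact: (sphi k [::]).
have mpart l : measurable_fun A (partial l (phi k)).
  apply: measurable_funTS; apply: continuous_measurable_rV => y.
  by apply: differentiable_continuous; exact: (sphi k [:: l]).
have mphi : measurable_fun A (phi k).
  apply: measurable_funTS; apply: continuous_measurable_rV => y.
  exact: differentiable_continuous.
have sq2 (a b : R) : `|a| ^+ 2 <= 2 * `|b - a| ^+ 2 + 2 * `|b| ^+ 2.
  by rewrite !real_normK ?num_real//; have := sqr_ge0 (2 * b - a); nra.
have h1 := @integral_sqr_le2 _ _ _ (lebesgue_rV R n) A rho v (fun x => phi k x - v x) (phi k)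
  mA rho0 mrho mv (measurable_funB mphi mv) mphi (fun x => sq2 _ _).
have sq2i x : `|partial i (phi k) x| ^+ 2 <=
    2 * `|enorm (grad (phi k) x - g x)| ^+ 2 + 2 * `|enorm (g x)| ^+ 2.
  have enorm_sqr (w : 'rV[R]_n) : `|w 0 i| ^+ 2 <= `|enorm w| ^+ 2.
    by rewrite lerXn2r ?nnegrE// [leRHS]ger0_norm ?enorm_ge0// enorm_ge_coord.
  have := enorm_sqr (grad (phi k) x - g x); have := enorm_sqr (g x).
  have := sq2 (partial i (phi k) x) (g x 0 i); rewrite !mxE [`|g x 0 i - _|]distrC; lra.
have mgrad l : measurable_fun A (fun x => (grad (phi k) x - g x) 0 l).
  rewrite (_ : (fun x => _) = fun x => partial l (phi k) x - g x 0 l); last first.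
    by apply/funext => x; rewrite !mxE.
  exact: measurable_funB.
have h2 := @integral_sqr_le2 _ _ _ (lebesgue_rV R n) A rho (partial i (phi k))
  (fun x => enorm (grad (phi k) x - g x)) (fun x => enorm (g x)) mA rho0 mrho (mpart i)
  (measurable_enorm mgrad) (measurable_enorm mg) sq2i.
have h3 := poinc _ (sphi k).
have phi0k' : (\int[m]_(x in G) (`|phi k x| ^+ 2 * rho x)%:E <= (e / K)%:E)%E.
  by move: phi0k; under eq_integral do rewrite subr0.
case: (\int[_]_(_ in _) (`|enorm (g _)| ^+ 2 * _)%:E)%E gfin
  (N0 (lebesgue_rV R n) A (fun x => enorm (g x))) h2 => //= G' _.
rewrite lee_fin => G0 h2.
have two0 : (0 <= 2%:E :> \bar R)%E by rewrite lee_fin.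
have {}h2 := le_trans h2 (leeD (lee_wpmul2l two0 phigk) (lexx _)).
have tL0 : (0 <= (2 * L)%:E)%E by rewrite lee_fin mulr_ge0.
have tL20 : (0 <= (2 * L ^+ 2)%:E)%E by rewrite lee_fin mulr_ge0// sqr_ge0.
have {}h3 := le_trans h3 (leeD (lee_wpmul2l tL0 phi0k') (lee_wpmul2l tL20 h2)).
have {}h1 := le_trans h1 (leeD (lee_wpmul2l two0 phivk) (lee_wpmul2l two0 h3)).
apply: (le_trans h1); rewrite -?(EFinM, EFinD) lee_fin le_eqVlt; apply/orP; left; apply/eqP.
have -> : e = K * (e / K) by rewrite mulrC divfK// gt_eqF.
rewrite [K * (e / K) / K]mulrAC divff ?gt_eqF// mul1r /K; ring.
Qed.

Theorem theorem4p6 (R : realType) (d : nat) (p : 'I_d.+1 -> nat)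
    (hp : forall i, (1 <= p i)%N) :
  exists CF : R, 0 < CF /\
  forall (n : 'I_d.+1 -> nat) (Xi : 'I_d.+1 -> seq R) (j : 'I_d.+1 -> nat)
    (hXi : forall i, open_knot_vector (p i) (n i) (Xi i))
    (hj : forall i, (j i < n i)%N),
    let beta := tensor_bspline p Xi j in
    let omega := supp beta in
    let Gamma := boundary (@unit_cube R d.+1) `&` boundary omega in
    (exists2 x, boundary (@unit_cube R d.+1) x & beta x <> 0) ->
    (0 < unit_cube_surface Gamma)%E /\
    forall (v : 'rV[R]_d.+1 -> R) (g : 'rV[R]_d.+1 -> 'rV[R]_d.+1),
      in_H1 omega beta v g ->
      is_trace (@unit_cube_surface R d) omega beta Gamma v g (fun=> 0) ->
      (L2norm (lebesgue_rV R d.+1) omega beta v <=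
       (CF * ediam omega)%:E *
         L2norm (lebesgue_rV R d.+1) omega beta (fun x => enorm (g x)))%E.
Proof.
exists 3; split => // n Xi j hXi hj beta omega Gamma [x xC /eqP bx]; split.
  exact: (unit_cube_surface_Gamma_gt0 hXi hj xC bx).
move=> v g [mv mg _ _ gfin] tr.
have b0 := tensor_bspline_ge0 hXi hj.
have momega : measurable omega := measurable_supp_tensor_bspline p Xi j.
have mb : measurable_fun omega beta.
  exact: measurable_funTS (measurable_tensor_bspline p Xi j).
have [i [L /andP[L0 Ld] poinc]] := tensor_poincare_smooth hp hXi hj xC bx.
move: gfin; rewrite !L2norm_sqrte// => gfin.
have {}gfin : (\int[lebesgue_rV R d.+1]_(x in omega)
    (`|enorm (g x)| ^+ 2 * beta x)%:E < +oo)%E.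
  by move: gfin; case: integral => [r| |]//= _; rewrite ?ltry ?ltNyr.
have := trace_zero_poincare momega b0 mb L0 mv mg poinc tr gfin.
set V := integral _ _ _; set G := integral _ _ _ => VG.
have d0 : 0 <= ediam omega := le_trans L0 Ld.
have G0 : (0 <= G)%E.
  by apply: integral_ge0 => y _; rewrite lee_fin mulr_ge0.
have -> : ((3 * ediam omega)%:E * sqrte G = sqrte (((3 * ediam omega) ^+ 2)%:E * G))%E.
  rewrite sqrteM ?lee_fin ?sqr_ge0//=; congr (_ * _)%E; congr EFin.
  by rewrite sqrtr_sqr ger0_norm// mulr_ge0.
rewrite lee_sqrt; last by rewrite mule_ge0// lee_fin sqr_ge0.
apply: (le_trans VG); apply: lee_wpmul2r => //; rewrite lee_fin.
have : L ^+ 2 <= ediam omega ^+ 2 by rewrite lerXn2r ?nnegrE.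
have := sqr_ge0 (ediam omega); nra.
Qed.
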